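(* For any (not necessarily unital) ring $R$ with stable rank one, the natural map $\mathrm{V}^*(R)\to \mathrm{CP}(R)$, sending the isomorphism class of a module $P$ to its Cuntz equivalence class $[P]$, is an isomorphism of commutative monoids.
   Context: Rings are associative, not necessarily unital unless stated. For an arbitrary ring $R$, $R^+ = \mathbb{Z}\oplus R$ denotes the Dorroh unitization, in which $R$ is a two-sided ideal. The ring $R$ has stable rank one if for all $a,b,x\in R^+$ with $a-1\in R$ and $xa+b=1$ there is $y\in R^+$ (equivalently $y \in R$) such that $a+yb$ is invertible in $R^+$. For unital $R$ this is equivalent to: for all $a,b\in R$ with $Ra+Rb=R$ there is $y\in R$ with $R(a+yb)=R$. $\mathcal{CP}(R)$ denotes the class of all countably generated unital projective right $R^+$-modules $P$ with $P=PR$. (For unital $R$ these are just the countably generated projective unital right $R$-modules.) $\mathrm{V}^*(R)$ is the commutative monoid of isomorphism classes of modules in $\mathcal{CP}(R)$, with addition induced by direct sum. For $P,Q\in\mathcal{CP}(R)$, $P\precsim Q$ means: for every finitely generated submodule $X$ of $P$ there are module homomorphisms $\phi\colon X\to Q$ and $\psi\colon Q\to P$ such that $\psi\circ\phi$ is the inclusion $X\hookrightarrow P$. Write $P\sim Q$ if $P\precsim Q$ and $Q\precsim P$. $\mathrm{CP}(R)=\mathcal{CP}(R)/{\sim}$, with addition $[P]+[Q]=[P\oplus Q]$, is a commutative monoid (the Cuntz semigroup of $R$). *)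

(* Defs.v *)
From HB Require Import structures.
From mathcomp Require Import all_boot all_algebra.
From mathcomp Require Import boolp.

Set Implicit Arguments.
Unset Strict Implicit.
Unset Printing Implicit Defensive.

Import GRing.Theory.
Local Open Scope ring_scope.

(* Associative rings, without any unit requirement. *)
HB.mixin Record Zmodule_isNonUnitalRing R of GRing.Zmodule R := {
  numul : R -> R -> R;
  numulA : associative numul;
  numulDl : left_distributive numul +%R;
  numulDr : right_distributive numul +%R
}.

#[short(type="nonUnitalRingType")]
HB.structure Definition NonUnitalRing :=
  {R of Zmodule_isNonUnitalRing R & GRing.Zmodule R}.

Section Dorroh.
Variable R : nonUnitalRingType.

Definition dorroh : Type := (int * R)%type.
HB.instance Definition _ := GRing.Zmodule.on dorroh.

Definition dorroh_one : dorroh := (1, 0).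
Definition dorroh_mul (a b : dorroh) : dorroh :=
  (a.1 * b.1, b.2 *~ a.1 + a.2 *~ b.1 + numul a.2 b.2).

Let numul0r (x : R) : numul 0 x = 0.
Proof. by apply: (addIr (numul 0 x)); rewrite -numulDl !add0r. Qed.
Let numulr0 (x : R) : numul x 0 = 0.
Proof. by apply: (addIr (numul x 0)); rewrite -numulDr !add0r. Qed.
Let numulNr (x y : R) : numul (- x) y = - numul x y.
Proof. by apply: (addIr (numul x y)); rewrite -numulDl !addNr numul0r. Qed.
Let numulrN (x y : R) : numul x (- y) = - numul x y.
Proof. by apply: (addIr (numul x y)); rewrite -numulDr !addNr numulr0. Qed.
Let numulnl (x y : R) n : numul (x *+ n) y = numul x y *+ n.
Proof. by elim: n => [|n IH]; rewrite ?mulr0n// !mulrS numulDl IH. Qed.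
Let numulnr (x y : R) n : numul x (y *+ n) = numul x y *+ n.
Proof. by elim: n => [|n IH]; rewrite ?mulr0n// !mulrS numulDr IH. Qed.
Let numulzl (x y : R) (n : int) : numul (x *~ n) y = numul x y *~ n.
Proof. by case: n => n; rewrite ?NegzE ?mulrNz -?pmulrn ?numulNr numulnl. Qed.
Let numulzr (x y : R) (n : int) : numul x (y *~ n) = numul x y *~ n.
Proof. by case: n => n; rewrite ?NegzE ?mulrNz -?pmulrn ?numulrN numulnr. Qed.

Fact dorroh_mulA : associative dorroh_mul.
Proof.
move=> [k x] [l y] [m z]; rewrite /dorroh_mul /=; congr pair; first exact: mulrA.
rewrite !mulrzDl !numulDl !numulDr !numulzl !numulzr -!mulrzA numulA.
rewrite [l * k]mulrC [m * k]mulrC !addrA.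
by rewrite [LHS](ACl (1*2*4*6*3*5*7)).
Qed.

Fact dorroh_mul1r : left_id dorroh_one dorroh_mul.
Proof. by case=> n x; rewrite /dorroh_mul /= mul1r mul0rz numul0r !addr0. Qed.

Fact dorroh_mulr1 : right_id dorroh_one dorroh_mul.
Proof.
by case=> n x; rewrite /dorroh_mul /= mulr1 mul0rz numulr0 add0r addr0.
Qed.

Fact dorroh_mulDl : left_distributive dorroh_mul +%R.
Proof.
move=> [k x] [l y] [m z]; rewrite /dorroh_mul /=; congr pair.
  exact: mulrDl.
by rewrite /= mulrzDl mulrzDr numulDl [RHS]addrACA; congr (_ + _); rewrite addrACA.
Qed.

Fact dorroh_mulDr : right_distributive dorroh_mul +%R.
Proof.
move=> [k x] [l y] [m z]; rewrite /dorroh_mul /=; congr pair.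
  exact: mulrDr.
by rewrite /= mulrzDl mulrzDr numulDr [RHS]addrACA; congr (_ + _); rewrite addrACA.
Qed.

Fact dorroh_oner_neq0 : dorroh_one != 0.
Proof. by []. Qed.

HB.instance Definition _ := GRing.Zmodule_isNzRing.Build dorroh
  dorroh_mulA dorroh_mul1r dorroh_mulr1 dorroh_mulDl dorroh_mulDr
  dorroh_oner_neq0.

Definition dorroh_in (r : R) : dorroh := (0, r).

End Dorroh.

Definition stable_rank_one (R : nonUnitalRingType) : Prop :=
  forall a b x : dorroh R,
    (exists r : R, a - 1 = dorroh_in r) -> x * a + b = 1 ->
  exists y u : dorroh R, u * (a + y * b) = 1 /\ (a + y * b) * u = 1.

Section Modules.
Variable S : nzRingType.

Definition finitely_generated (U : lmodType S) : Prop :=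
  exists n (g : 'I_n -> U), forall x, exists c : 'I_n -> S,
    x = \sum_(i < n) c i *: g i.

Definition countably_generated (U : lmodType S) : Prop :=
  exists g : nat -> U, forall x, exists n (c : nat -> S),
    x = \sum_(i < n) c i *: g i.

Definition projective (U : lmodType S) : Prop :=
  forall (M N : lmodType S) (f : {linear M -> N}) (g : {linear U -> N}),
    (forall y, exists x, f x = y) ->
  exists h : {linear U -> M}, forall u, f (h u) = g u.

Definition linear_iso (U V : lmodType S) : Prop :=
  exists f : {linear U -> V}, bijective f.

Record submodule (U : lmodType S) (X : submodClosed U) :=
  Submodule { submodule_val :> U; _ : submodule_val \in X }.

Section SubmoduleInst.
Variables (U : lmodType S) (X : submodClosed U).
HB.instance Definition _ := [isSub of submodule X for @submodule_val U X].
HB.instance Definition _ := [Choice of submodule X by <:].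
HB.instance Definition _ := [SubChoice_isSubLmodule of submodule X by <:].
End SubmoduleInst.

Definition precsim (P Q : lmodType S) : Prop :=
  forall X : submodClosed P, finitely_generated (submodule X) ->
  exists (phi : {linear submodule X -> Q}) (psi : {linear Q -> P}),
    forall x : submodule X, psi (phi x) = val x.

Definition cuntz_equiv (P Q : lmodType S) : Prop :=
  precsim P Q /\ precsim Q P.

Definition mklinear (U V : lmodType S) (f : U -> V) (fL : linear f) :
  {linear U -> V} := HB.pack f (GRing.isLinear.Build S U V _ f fL).

Lemma linear_iso_refl U : linear_iso U U.
Proof. by exists idfun; exists id. Qed.

Lemma linear_iso_sym U V : linear_iso U V -> linear_iso V U.
Proof.
case=> f [g fK gK].
have gL : linear g.
  by move=> a x y; apply: (can_inj fK); rewrite linearP !gK.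
pose gl : {linear V -> U} := mklinear gL.
by exists gl; exists f.
Qed.

Lemma linear_iso_trans U V W :
  linear_iso U V -> linear_iso V W -> linear_iso U W.
Proof.
by case=> f bf [g bg]; exists (g \o f : {linear U -> W}); apply: bij_comp.
Qed.

Lemma linear_iso_pair U U' V V' :
  linear_iso U U' -> linear_iso V V' -> linear_iso (U * V)%type (U' * V')%type.
Proof.
case=> f [f' fK f'K] [g [g' gK g'K]].
pose h (x : U * V) : U' * V' := (f x.1, g x.2).
have hL : linear h by move=> a x y; rewrite /h /= !linearP.
pose hl : {linear (U * V)%type -> (U' * V')%type} := mklinear hL.
exists hl; exists (fun y => (f' y.1, g' y.2)) => -[x y] /=.
  by rewrite fK gK.
by rewrite /h /= f'K g'K.
Qed.

Section Image.
Variables (U V : lmodType S) (f : {linear U -> V}).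

Definition limage : {pred V} := [pred y | `[< exists x, f x = y >]].

Fact limage_submod_closed : submod_closed limage.
Proof.
split=> [|a y z]; rewrite ?inE; first by apply/asboolP; exists 0; exact: linear0.
move=> /asboolP[x <-] /asboolP[x' <-]; apply/asboolP.
by exists (a *: x + x'); rewrite linearP.
Qed.
HB.instance Definition _ :=
  GRing.isSubmodClosed.Build S V limage limage_submod_closed.

Fact limage_mem x : f x \in limage.
Proof. by rewrite inE; apply/asboolP; exists x. Qed.

Definition colimage_fun (x : U) : submodule limage := Submodule (limage_mem x).

Fact colimage_linear : linear colimage_fun.
Proof. by move=> a x y; apply: val_inj; rewrite /= linearP. Qed.
HB.instance Definition _ :=
  GRing.isLinear.Build S U (submodule limage) _ colimage_fun colimage_linear.

Lemma limage_fg :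
  finitely_generated U -> finitely_generated (submodule limage).
Proof.
case=> n [g gU]; exists n, (fun i => colimage_fun (g i)) => -[y yf].
have := yf; rewrite inE => /asboolP[x fx].
have [c xE] := gU x; exists c; apply: val_inj.
rewrite linear_sum /= -fx xE linear_sum.
by apply: eq_bigr => i _; rewrite !linearZ.
Qed.

End Image.

Lemma precsim_trans P Q T : precsim P Q -> precsim Q T -> precsim P T.
Proof.
move=> PQ QT X Xfg; have [phi [psi psiK]] := PQ X Xfg.
have [phi' [psi' psiK']] := QT _ (limage_fg phi Xfg).
exists (phi' \o colimage_fun phi : {linear _ -> _}).
exists (psi \o psi' : {linear _ -> _}) => x /=.
by rewrite psiK' /= psiK.
Qed.

Lemma linear_iso_precsim P Q : linear_iso P Q -> precsim P Q.
Proof.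
move=> PQ; have [f [g fK gK]] := PQ.
have gL : linear g.
  by move=> a x y; apply: (can_inj fK); rewrite linearP !gK.
pose gl : {linear Q -> P} := mklinear gL.
move=> X _; exists (f \o (val : {linear submodule X -> P}) : {linear _ -> _}), gl.
by move=> x /=; rewrite fK.
Qed.

Lemma precsim_pair P P' Q Q' :
  precsim P P' -> precsim Q Q' -> precsim (P * Q)%type (P' * Q')%type.
Proof.
move=> PP QQ X Xfg.
pose p1 := fst \o (val : {linear submodule X -> (P * Q)%type}) : {linear _ -> _}.
pose p2 := snd \o (val : {linear submodule X -> (P * Q)%type}) : {linear _ -> _}.
have [phi1 [psi1 psi1K]] := PP _ (limage_fg p1 Xfg).
have [phi2 [psi2 psi2K]] := QQ _ (limage_fg p2 Xfg).
pose h x : P' * Q' := (phi1 (colimage_fun p1 x), phi2 (colimage_fun p2 x)).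
have hL : linear h by move=> a x y; rewrite /h !linearP.
pose k (x : P' * Q') : P * Q := (psi1 x.1, psi2 x.2).
have kL : linear k by move=> a x y; rewrite /k /= !linearP.
exists (mklinear hL).
exists (mklinear kL) => x.
by rewrite /= /k /h /= psi1K psi2K /=; case: (val x).
Qed.

Lemma cuntz_equiv_refl P : cuntz_equiv P P.
Proof. by split; apply: linear_iso_precsim; exact: linear_iso_refl. Qed.

Lemma cuntz_equiv_sym P Q : cuntz_equiv P Q -> cuntz_equiv Q P.
Proof. by case. Qed.

Lemma cuntz_equiv_trans P Q T :
  cuntz_equiv P Q -> cuntz_equiv Q T -> cuntz_equiv P T.
Proof. by move=> [PQ QP] [QT TQ]; split; apply: precsim_trans; eauto. Qed.

Lemma cuntz_equiv_pair P P' Q Q' : cuntz_equiv P P' -> cuntz_equiv Q Q' ->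
  cuntz_equiv (P * Q)%type (P' * Q')%type.
Proof. by move=> [? ?] [? ?]; split; apply: precsim_pair. Qed.

Lemma linear_iso_cuntz P Q : linear_iso P Q -> cuntz_equiv P Q.
Proof.
move=> PQ; split; apply: linear_iso_precsim => //; exact: linear_iso_sym.
Qed.

Lemma linear_iso_pairC (U V : lmodType S) : linear_iso (U * V)%type (V * U)%type.
Proof.
pose h (x : U * V) : V * U := (x.2, x.1).
have hL : linear h by [].
exists (mklinear hL).
by exists (fun x => (x.2, x.1)) => -[].
Qed.

Lemma linear_iso_pairA (U V W : lmodType S) :
  linear_iso (U * (V * W))%type ((U * V) * W)%type.
Proof.
pose h (x : U * (V * W)) : (U * V) * W := ((x.1, x.2.1), x.2.2).
have hL : linear h by [].
exists (mklinear hL).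
by exists (fun x => (x.1.1, (x.1.2, x.2))) => [[? []]|[[]]].
Qed.

Lemma linear_iso_pair0 (U : lmodType S) : linear_iso ('rV[S]_0 * U)%type U.
Proof.
exists (snd : {linear ('rV[S]_0 * U)%type -> U}).
by exists (fun x => (0, x)) => [[x y]|] //=; rewrite [x]thinmx0.
Qed.

Lemma countably_generated0 : countably_generated 'rV[S]_0.
Proof.
exists (fun=> 0) => x; exists 0, (fun=> 0).
by rewrite big_ord0 [x]thinmx0.
Qed.

Lemma countably_generated_pair U V : countably_generated U ->
  countably_generated V -> countably_generated (U * V)%type.
Proof.
move=> [g gU] [h hV].
exists (fun i => if odd i then (0, h i./2) else (g i./2, 0)) => -[x y].
have [n [c ->]] := gU x; have [m [d ->]] := hV y.
pose c' i := if (i < n)%N then c i else 0.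
pose d' i := if (i < m)%N then d i else 0.
have trunc (W : lmodType S) (k : nat -> W) (e : nat -> S) p q : (p <= q)%N ->
    \sum_(i < p) e i *: k i =
    \sum_(i < q) (if (i < p)%N then e i else 0) *: k i.
  move=> pq; rewrite (big_ord_widen q (fun i => e i *: k i) pq) big_mkcond /=.
  by apply: eq_bigr => i _; case: ifP; rewrite ?scale0r.
rewrite (trunc _ _ _ _ _ (leq_maxl n m)) (trunc _ _ _ _ _ (leq_maxr n m)).
exists (maxn n m).*2, (fun i => if odd i then d' i./2 else c' i./2).
elim: (maxn n m) => [|k IH]; first by rewrite !big_ord0.
rewrite doubleS !big_ord_recr /= -IH /= odd_double /= uphalf_double doubleK.
by congr pair => /=; rewrite !scaler0 ?addr0.
Qed.

Lemma projective0 : projective 'rV[S]_0.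
Proof.
move=> M N f g _; exists (\0 : {linear _ -> _}) => u.
by rewrite [u]thinmx0 !linear0.
Qed.

Lemma projective_pair U V :
  projective U -> projective V -> projective (U * V)%type.
Proof.
move=> Up Vp M N f g fS.
have g1L : linear (fun x : U => g (x, 0)).
  move=> a x y; rewrite -linearP; congr (g _).
  by congr pair; rewrite /= scaler0 addr0.
have g2L : linear (fun x : V => g (0, x)).
  move=> a x y; rewrite -linearP; congr (g _).
  by congr pair; rewrite /= scaler0 addr0.
have [h1 h1E] := Up M N f (mklinear g1L) fS.
have [h2 h2E] := Vp M N f (mklinear g2L) fS.
pose h (x : U * V) := h1 x.1 + h2 x.2.
have hL : linear h.
  by move=> a x y; rewrite /h /= !linearP scalerDr addrACA.
exists (mklinear hL) => -[x y].
rewrite /= /h linearD h1E h2E /= -linearD.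
by congr (g _); congr pair; rewrite /= ?addr0 ?add0r.
Qed.

End Modules.

(* Set-theoretic quotient of a possibly large type. The generic [{eq_quot _}],
   as well as [nmodType], needs a [choiceType]; all MathComp structures live in
   the universe of the carriers of [lmodType]s, so that these cannot be used on
   a type whose elements are modules. *)
Definition classes (T : Type) (e : T -> T -> Prop) : Type :=
  {C : T -> Prop | exists x, C = e x}.

Lemma classes_inj (T : Type) (e : T -> T -> Prop) (C D : classes e) :
  sval C = sval D -> C = D.
Proof. by apply: eq_sig_hprop => ? ? ?; exact: Prop_irrelevance. Qed.

Definition class_of (T : Type) (e : T -> T -> Prop) (x : T) : classes e :=
  exist _ (e x) (ex_intro _ x erefl).

Definition class_repr (T : Type) (e : T -> T -> Prop) (C : classes e) : T :=
  sval (cid (svalP C)).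

Lemma class_reprK (T : Type) (e : T -> T -> Prop) (C : classes e) :
  class_of e (class_repr C) = C.
Proof. by apply/classes_inj; rewrite /= -(svalP (cid (svalP C))). Qed.

Lemma class_ofP (T : Type) (e : T -> T -> Prop) :
    (forall x, e x x) -> (forall x y, e x y -> e y x) ->
    (forall x y z, e x y -> e y z -> e x z) ->
  forall x y, class_of e x = class_of e y <-> e x y.
Proof.
move=> er es et x y; split=> [/(congr1 sval) /= exy|exy].
  by rewrite exy; exact: er.
apply/classes_inj/funext => z; apply/propext; split; last exact: et.
exact/et/es.
Qed.

Section CP.
Variable R : nonUnitalRingType.

(* A right module over the Dorroh unitization is a left module over its
   converse ring: [(a : (dorroh R)^c) *: p] stands for [p a]. *)
Definition absorbed (P : lmodType (dorroh R)^c) : Prop :=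
  forall p : P, exists n (q : 'I_n -> P) (r : 'I_n -> R),
    p = \sum_(i < n) (dorroh_in (r i) : (dorroh R)^c) *: q i.

Record cpModule := CPModule {
  cp_sort :> lmodType (dorroh R)^c;
  cp_countably_generated : countably_generated cp_sort;
  cp_projective : projective cp_sort;
  cp_absorbed : absorbed cp_sort }.
Arguments cp_countably_generated : clear implicits.
Arguments cp_projective : clear implicits.
Arguments cp_absorbed : clear implicits.

Fact absorbed0 : absorbed 'rV[(dorroh R)^c]_0.
Proof.
move=> x; exists 0, (fun=> 0), (fun=> 0).
by rewrite big_ord0 [x]thinmx0.
Qed.

Fact absorbed_pair P Q : absorbed P -> absorbed Q -> absorbed (P * Q)%type.
Proof.
move=> PR QR [x y]; have [n [q [r ->]]] := PR x; have [m [q' [r' ->]]] := QR y.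
exists (n + m), (fun i => match split i with inl j => (q j, 0)
  | inr j => (0, q' j) end).
exists (fun i => match split i with inl j => r j | inr j => r' j end).
rewrite big_split_ord /=.
under [X in _ = X + _]eq_bigr do rewrite (unsplitK (inl _)).
under [X in _ = _ + X]eq_bigr do rewrite (unsplitK (inr _)).
rewrite [RHS]surjective_pairing /= !raddf_sum /=; congr pair.
  by rewrite [X in _ + X]big1 ?addr0// => i _; rewrite scaler0.
by rewrite [X in X + _]big1 ?add0r// => i _; rewrite scaler0.
Qed.

Definition cp0 : cpModule :=
  CPModule (@countably_generated0 _) (@projective0 _) absorbed0.

Definition cp_sum (P Q : cpModule) : cpModule :=
  @CPModule (P * Q)%type
    (countably_generated_pair (cp_countably_generated P) (cp_countably_generated Q))
    (projective_pair (cp_projective P) (cp_projective Q))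
    (absorbed_pair (cp_absorbed P) (cp_absorbed Q)).

Definition cp_iso (P Q : cpModule) : Prop := linear_iso P Q.
Definition cp_cuntz (P Q : cpModule) : Prop := cuntz_equiv P Q.

Definition Vstar : Type := classes cp_iso.
Definition CP : Type := classes cp_cuntz.

Definition iso_class : cpModule -> Vstar := class_of cp_iso.
Definition cuntz_class : cpModule -> CP := class_of cp_cuntz.

Lemma iso_classP P Q : iso_class P = iso_class Q <-> linear_iso P Q.
Proof.
apply: (class_ofP (e := cp_iso)) => [x|x y|x y z].
- exact: linear_iso_refl.
- exact: linear_iso_sym.
- exact: linear_iso_trans.
Qed.

Lemma cuntz_classP P Q : cuntz_class P = cuntz_class Q <-> cuntz_equiv P Q.
Proof.
apply: (class_ofP (e := cp_cuntz)) => [x|x y|x y z].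
- exact: cuntz_equiv_refl.
- exact: cuntz_equiv_sym.
- exact: cuntz_equiv_trans.
Qed.

Lemma iso_class_repr x : iso_class (class_repr x) = x.
Proof. exact: class_reprK. Qed.

Lemma cuntz_class_repr x : cuntz_class (class_repr x) = x.
Proof. exact: class_reprK. Qed.

Definition Vstar_zero : Vstar := iso_class cp0.
Definition CP_zero : CP := cuntz_class cp0.

(* Sums of classes are computed on representatives; [Vstar_addE] and [CP_addE]
   below show that the choice of representatives does not matter. *)
Definition Vstar_add (x y : Vstar) : Vstar :=
  iso_class (cp_sum (class_repr x) (class_repr y)).
Definition CP_add (x y : CP) : CP :=
  cuntz_class (cp_sum (class_repr x) (class_repr y)).

Lemma Vstar_addE P Q :
  Vstar_add (iso_class P) (iso_class Q) = iso_class (cp_sum P Q).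
Proof.
by apply/iso_classP; apply: linear_iso_pair; apply/iso_classP/iso_class_repr.
Qed.

Lemma CP_addE P Q :
  CP_add (cuntz_class P) (cuntz_class Q) = cuntz_class (cp_sum P Q).
Proof.
by apply/cuntz_classP; apply: cuntz_equiv_pair;
  apply/cuntz_classP/cuntz_class_repr.
Qed.

Fact Vstar_addA : associative Vstar_add.
Proof.
move=> x y z; rewrite -[x]iso_class_repr -[y]iso_class_repr -[z]iso_class_repr.
by rewrite !Vstar_addE; apply/iso_classP/linear_iso_pairA.
Qed.

Fact Vstar_addC : commutative Vstar_add.
Proof. by move=> x y; apply/iso_classP/linear_iso_pairC. Qed.

Fact Vstar_add0 : left_id Vstar_zero Vstar_add.
Proof.
move=> x; rewrite -[x]iso_class_repr Vstar_addE.
exact/iso_classP/linear_iso_pair0.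
Qed.

HB.instance Definition _ := Monoid.isComLaw.Build Vstar Vstar_zero Vstar_add
  Vstar_addA Vstar_addC Vstar_add0.

Fact CP_addA : associative CP_add.
Proof.
move=> x y z; rewrite -[x]cuntz_class_repr -[y]cuntz_class_repr.
rewrite -[z]cuntz_class_repr !CP_addE.
exact/cuntz_classP/linear_iso_cuntz/linear_iso_pairA.
Qed.

Fact CP_addC : commutative CP_add.
Proof.
by move=> x y; apply/cuntz_classP/linear_iso_cuntz/linear_iso_pairC.
Qed.

Fact CP_add0 : left_id CP_zero CP_add.
Proof.
move=> x; rewrite -[x]cuntz_class_repr CP_addE.
exact/cuntz_classP/linear_iso_cuntz/linear_iso_pair0.
Qed.

HB.instance Definition _ := Monoid.isComLaw.Build CP CP_zero CP_add
  CP_addA CP_addC CP_add0.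

End CP.

(* Main.v *)
Require Import Defs.
From HB Require Import structures.
From mathcomp Require Import all_boot all_algebra.
From mathcomp Require Import boolp.

Set Implicit Arguments.
Unset Strict Implicit.
Unset Printing Implicit Defensive.

Import GRing.Theory.
Local Open Scope ring_scope.

(** Everything reduces to one implication: Cuntz equivalent [P] and [Q] are
isomorphic. The other parts of the theorem are formal.

Write [T] for the unitization and [eps] for its augmentation, so that the ring
itself is the kernel of [eps]. Suppose [P] and [Q] embed into each other
locally: on every finite subset of [P] some [a : P -> Q] has a left inverse
[b : Q -> P], and conversely. To obtain an isomorphism one builds such pairs on
growing finite sets [L 0], [L 1], ... of [P] in a back-and-forth manner
([back_and_forth_step]), so that each [a] agrees with the previous one on the
previous finite set, each generator of [P] is eventually in some [L n] and each
generator of [Q] is eventually hit. The limit is then bijective ([limit_iso]).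

The difficulty is to make a new partial embedding [phi] agree with the old one
[a] on [L]. Both have left inverses [psi] and [b] on the relevant finite sets;
then [s = a psi] and [t = phi b] are endomorphisms of [Q] with [t s = id] on
[phi L], and if some automorphism [u] of [Q] coincides with [s] on [phi L], then
[u phi] is a partial embedding that agrees with [a] on [L]. The existence of [u]
([extend_to_automorphism]) is where stable rank one is used: [s] may be replaced
by a map [1 + (s - 1) c], where [c] has finite rank and is the identity on the
finite set, and similarly for [t]; if [x a] is the identity on [phi L], then
[a + y (1 - x a)] coincides with [a] there whatever [y] is, and stable rank one
of the ring of finite rank endomorphisms makes it invertible for some [y].

Finally, stable rank one passes from the ring to its finite rank endomorphisms
in two stages: to [n] by [n] matrices, by the classical block reduction
([mx_stable_add]), and from matrices to [Q] by the equivalence between the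
invertibility of [1 + pi D] on [Q] and that of [1 + D pi] on row vectors, where
[pi] maps row vectors to [Q] and [D] goes the other way. The condition
[Q = Q R] makes the matrices that arise congruent to the identity modulo the
kernel of [eps]. *)

(** * Stable rank one for matrices *)

Section Completable.
Variable T : nzRingType.

Definition inverse_mx n (u v : 'M[T]_n) : Prop :=
  u *m v = 1%:M /\ v *m u = 1%:M.

(** Matrices act on row vectors from the right, so [a *m x] is the composite of
first [a], then [x]: as maps, this is the condition of stable rank one for
[x a + (1 - x a) = 1]. *)
Definition completable n (a x : 'M[T]_n) : Prop :=
  exists y u : 'M[T]_n, inverse_mx (a + (1%:M - a *m x) *m y) u.

Lemma inverse_mx_mul n (u u' v v' : 'M[T]_n) :
  inverse_mx u u' -> inverse_mx v v' -> inverse_mx (u *m v) (v' *m u').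
Proof.
move=> [uu' u'u] [vv' v'v]; split.
  by rewrite mulmxA -(mulmxA u) vv' mulmx1.
by rewrite mulmxA -(mulmxA v') u'u mulmx1.
Qed.

Lemma inverse_mx_sym n (u v : 'M[T]_n) : inverse_mx u v -> inverse_mx v u.
Proof. by case. Qed.

Lemma inverse_mx_lower m n (c : 'M[T]_(n, m)) (u u' : 'M[T]_m)
    (d d' : 'M[T]_n) : inverse_mx u u' -> inverse_mx d d' ->
  inverse_mx (block_mx u 0 c d) (block_mx u' 0 (- (d' *m c *m u')) d').
Proof.
move=> [uu' u'u] [dd' d'd]; rewrite /inverse_mx !mulmx_block.
rewrite !mulmx0 !mul0mx ?addr0 ?add0r uu' u'u dd' d'd.
rewrite mulmxN mulNmx !mulmxA dd' mul1mx -!mulmxA u'u mulmx1 subrr addNr.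
by rewrite -scalar_mx_block.
Qed.

Lemma inverse_mx_upper m n (c : 'M[T]_(m, n)) (u u' : 'M[T]_m)
    (d d' : 'M[T]_n) : inverse_mx u u' -> inverse_mx d d' ->
  inverse_mx (block_mx u c 0 d) (block_mx u' (- (u' *m c *m d')) 0 d').
Proof.
move=> [uu' u'u] [dd' d'd]; rewrite /inverse_mx !mulmx_block.
rewrite !mulmx0 !mul0mx ?addr0 ?add0r uu' u'u dd' d'd.
rewrite mulmxN mulNmx !mulmxA uu' mul1mx -!mulmxA d'd mulmx1 subrr addNr.
by rewrite -scalar_mx_block.
Qed.

Lemma inverse_mx1 n : inverse_mx (1%:M : 'M[T]_n) 1%:M.
Proof. by split; rewrite mulmx1. Qed.

(** Multiplying [a] by invertible matrices and [x] by their inverses on the other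
sides conjugates [1 - a x], so that corrections correspond. *)
Lemma completable_mul n (v v' u u' a x : 'M[T]_n) :
  inverse_mx v v' -> inverse_mx u u' ->
  completable (v *m a *m u) (u' *m x *m v') -> completable a x.
Proof.
move=> vI uI [y [w wI]]; exists (v' *m y *m u'), (u *m w *m v).
have [uu' u'u] := uI; have [vv' v'v] := vI.
have -> : a + (1%:M - a *m x) *m (v' *m y *m u') =
    v' *m (v *m a *m u + (1%:M - v *m a *m u *m (u' *m x *m v')) *m y) *m u'.
  rewrite mulmxDr [RHS]mulmxDl; congr (_ + _).
    by rewrite !mulmxA v'v mul1mx -mulmxA uu' mulmx1.
  rewrite !mulmxA -(mulmxA (v *m a)) uu' mulmx1.
  congr (_ *m _ *m _); rewrite mulmxBr mulmxBl mulmx1 mul1mx !mulmxA.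
  by rewrite v'v mul1mx.
rewrite -(mulmxA u); apply: inverse_mx_mul (inverse_mx_sym uI).
exact: inverse_mx_mul (inverse_mx_sym vI) wI.
Qed.

(** Holds because [1 - (a + b z) x = b (1 - z x)] when [b = 1 - a x]: a
correction of the new matrix is again a correction of [a]. *)
Lemma completable_add n (z a x : 'M[T]_n) :
  completable (a + (1%:M - a *m x) *m z) x -> completable a x.
Proof.
move=> [y [u uI]]; exists (z + (1%:M - z *m x) *m y), u.
set b := 1%:M - a *m x in uI *.
suff -> : a + b *m (z + (1%:M - z *m x) *m y) =
  a + b *m z + (1%:M - (a + b *m z) *m x) *m y by [].
rewrite -addrA mulmxDr; congr (_ + (_ + _)); rewrite mulmxA; congr (_ *m _).
by rewrite mulmxBr mulmx1 (mulmxDl a) opprD addrA mulmxA.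
Qed.

(** A correction of the lower right block alone leaves an upper triangular
matrix with an invertible diagonal. *)
Lemma completable_diag m n (d : 'M[T]_n) (x : 'M[T]_(m + n)) :
  completable d (drsubmx x) -> completable (block_mx 1%:M 0 0 d) x.
Proof.
move=> [w [u uI]]; exists (block_mx 0 0 0 w).
set b := 1%:M - _.
have -> : block_mx 1%:M 0 0 d + b *m block_mx 0 0 0 w =
    block_mx 1%:M (- (ursubmx x *m w)) 0 (d + (1%:M - d *m drsubmx x) *m w).
  rewrite /b -{1}[x]submxK mulmx_block !mul0mx !mul1mx !addr0 !add0r.
  rewrite scalar_mx_block opp_block_mx add_block_mx mulmx_block.
  by rewrite !mulmx0 !add0r add_block_mx !addr0 !add0r mulNmx.
exists (block_mx 1%:M (- (1%:M *m (- (ursubmx x *m w)) *m u)) 0 u).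
exact: inverse_mx_upper (inverse_mx1 m) uI.
Qed.

Variables (K : nzRingType) (eps : {rmorphism T -> K}).

(** With [eps] the augmentation of a unitization, the condition on [a] says that
[a - 1] has its entries in the ring. The same condition on [x] ensures that all
the matrices in the block reduction below remain congruent to the identity. *)
Definition mx_stable n : Prop := forall a x : 'M[T]_n,
  map_mx eps a = 1%:M -> map_mx eps x = 1%:M -> completable a x.

(** The upper left block of [a x + (1 - a x) = 1] says that
[a11 x11 + (a12 x21 + b11) = 1], where [b = 1 - a x], so that
[a11 + (a12 x21 + b11) y] is invertible for some [y]. A column operation and a
correction put this matrix in place of [a11]; it then serves as a pivot, and the
problem is reduced to the lower right block. *)
Lemma mx_stable_add m n : mx_stable m -> mx_stable n -> mx_stable (m + n).
Proof.
move=> mS nS.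
have eps_blocks k l (a : 'M[T]_(k + l)) : map_mx eps a = 1%:M ->
   [/\ map_mx eps (ulsubmx a) = 1%:M, map_mx eps (ursubmx a) = 0,
       map_mx eps (dlsubmx a) = 0 & map_mx eps (drsubmx a) = 1%:M].
  by rewrite -{1}[a]submxK map_block_mx scalar_mx_block => /eq_block_mx.
have eps_block (p : 'M[T]_m) q r (t : 'M[T]_n) : map_mx eps p = 1%:M ->
    map_mx eps q = 0 -> map_mx eps r = 0 -> map_mx eps t = 1%:M ->
    map_mx eps (block_mx p q r t) = 1%:M.
  by rewrite map_block_mx => -> -> -> ->; rewrite -scalar_mx_block.
(* If the upper left block is invertible, elimination turns it into [1]
   and makes [a] block diagonal. *)
have clear (a x : 'M[T]_(m + n)) u : inverse_mx (ulsubmx a) u ->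
    map_mx eps a = 1%:M -> map_mx eps x = 1%:M -> completable a x.
  move=> uI aE xE; have [uu' u'u] := uI.
  pose b := ursubmx a; pose c := dlsubmx a.
  have [ulE bE cE drE] := eps_blocks _ _ a aE.
  have uE : map_mx eps u = 1%:M.
    by rewrite -[LHS]mulmx1 -ulE -map_mxM u'u map_mx1.
  have vI := inverse_mx_lower (- (c *m u)) (inverse_mx_sym uI) (inverse_mx1 n).
  have wI := inverse_mx_upper (- (u *m b)) (inverse_mx1 m) (inverse_mx1 n).
  apply: (completable_mul vI wI).
  set x' := (X in completable _ X).
  have x'E : map_mx eps x' = 1%:M.
    by rewrite /x' !map_mxM xE mulmx1 eps_block ?mul1mx ?eps_block // ?map_mx1
      ?map_mx0 // !(map_mxN, map_mxM) ?bE ?cE !(mulmx0, mul0mx, oppr0).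
  rewrite (_ : _ *m _ = block_mx 1%:M 0 0 (drsubmx a - c *m u *m b)).
    apply: completable_diag; apply: nS; last by case: (eps_blocks _ _ x' x'E).
    by rewrite map_mxB !map_mxM cE !mul0mx subr0.
  rewrite -{1}[a]submxK -/b -/c !mulmx_block.
  rewrite !mul0mx !mul1mx !addr0 ?mulmx0 ?mulmx1 ?addr0 u'u mul1mx.
  by rewrite addNr !mulNmx -!mulmxA u'u mulmx1 addNr mul0mx add0r mulmxA addrC.
move=> a x aE xE.
have [a1 a2 a3 a4] := eps_blocks _ _ a aE.
have [x1 x2 x3 x4] := eps_blocks _ _ x xE.
have [y [u uI]] := mS _ _ a1 x1.
pose e := dlsubmx x *m y.
have eI := inverse_mx_lower e (inverse_mx1 m) (inverse_mx1 n).
apply: (completable_mul (inverse_mx1 _) eI); rewrite mul1mx mulmx1.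
apply: (completable_add (z := block_mx y 0 0 0)).
have epsE : map_mx eps e = 0 by rewrite map_mxM x3 mul0mx.
have eE : map_mx eps (block_mx 1%:M 0 e 1%:M) = 1%:M.
  by rewrite map_block_mx epsE !map_mx0 !map_mx1 -scalar_mx_block.
have e'E : map_mx eps (block_mx 1%:M 0 (- (1%:M *m e *m 1%:M)) 1%:M) = 1%:M.
  rewrite map_block_mx mul1mx mulmx1 map_mxN epsE oppr0 !map_mx0 !map_mx1.
  by rewrite -scalar_mx_block.
apply: (clear _ _ u); last 1 first.
- by rewrite map_mxM e'E xE mulmx1.
- rewrite (_ : ulsubmx _ = ulsubmx a + (1%:M - ulsubmx a *m ulsubmx x) *m y) //.
  rewrite mulmxA -(mulmxA a) (proj1 eI) mulmx1.
  rewrite -{1 2}[a]submxK -{1}[x]submxK !mulmx_block scalar_mx_block.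
  rewrite opp_block_mx add_block_mx mulmx_block add_block_mx block_mxKul.
  rewrite !mulmx0 !mulmx1 !addr0 /e !mulmxBl mul1mx mulmxDl !mulmxA opprD.
  rewrite -!addrA; congr (_ + _); rewrite addrCA; congr (_ + _).
  by rewrite addrC addrNK.
- rewrite map_mxD !map_mxM map_mxB !map_mxM map_mx1 eE e'E aE xE.
  by rewrite !mulmx1 subrr mul0mx addr0.
Qed.

Hypothesis eps_stable : forall a x : T, eps a = 1 -> eps x = 1 ->
  exists y u : T,
    (a + (1 - a * x) * y) * u = 1 /\ u * (a + (1 - a * x) * y) = 1.

Lemma mx_stable_all n : mx_stable n.
Proof.
elim: n => [|n IH]; first by exists 0, 0; split; apply/matrixP => -[].
apply: (@mx_stable_add 1 n) IH => a x; rewrite [a]mx11_scalar [x]mx11_scalar.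
rewrite !map_scalar_mx => /(congr1 (fun A : 'M_1 => A 0 0)).
rewrite !mxE /= => a1.
move=> /(congr1 (fun A : 'M_1 => A 0 0)); rewrite !mxE /= => x1.
have [y [u [yu uy]]] := eps_stable a1 x1; exists y%:M, u%:M.
rewrite /inverse_mx -!(scalar_mxM, raddfB, raddfD) /=.
by rewrite yu uy.
Qed.

End Completable.

(** * Finite rank maps of countably generated projective modules *)

Section LocalUnits.
Variables (T : nzRingType) (Q : lmodType T).

Section FreeModule.
Variable g : nat -> Q.

Definition poly_comb (p : {poly T}) : Q := \sum_(i < size p) p`_i *: g i.

(** Sums up to any bound on the size agree, which is what makes [poly_comb]
linear. *)
Lemma poly_combE n (p : {poly T}) : (size p <= n)%N ->
  poly_comb p = \sum_(i < n) p`_i *: g i.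
Proof.
move=> pn; rewrite /poly_comb (big_ord_widen n (fun i => p`_i *: g i) pn).
rewrite big_mkcond; apply: eq_bigr => i _; case: ltnP => // ?.
by rewrite nth_default ?scale0r.
Qed.

Lemma poly_comb_linear : linear poly_comb.
Proof.
move=> a p q; pose n := maxn (size (a *: p + q)) (maxn (size p) (size q)).
rewrite !(@poly_combE n) ?leq_max ?leqnn ?orbT // scaler_sumr -big_split.
by apply: eq_bigr => i _; rewrite coefD coefZ scalerDl scalerA.
Qed.

End FreeModule.

(** [{poly T}] serves as a free module of countable rank, in which [Q] embeds as
a direct summand: a finite set then lies among the polynomials of bounded
size. *)
Lemma local_unit (s : seq Q) : countably_generated Q -> projective Q ->
  exists n (iota : {linear Q -> 'rV[T]_n}) (pi : {linear 'rV[T]_n -> Q}),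
    {in s, forall q, pi (iota q) = q}.
Proof.
move=> [g gQ] Qproj.
pose G := mklinear (poly_comb_linear g).
have Gsurj q : exists p, G p = q.
  have [n [c ->]] := gQ q; exists (\poly_(i < n) c i).
  rewrite /G /= (poly_combE _ (size_poly n c)); apply: eq_bigr => i _.
  by rewrite coef_poly ltn_ord.
have [h hE] := Qproj _ _ G idfun Gsurj.
pose n := (\max_(q <- s) size (h q))%N.
exists n, (poly_rV \o h : {linear _ -> _}), (G \o rVpoly : {linear _ -> _}).
move=> q qs /=; rewrite poly_rV_K; first exact: hE.
exact: (leq_bigmax_seq (F := fun q => size (h q)) q qs isT).
Qed.

End LocalUnits.

(** * Automorphisms that extend a partial identification *)

Section BackAndForth.
Variables (T K : nzRingType) (eps : {rmorphism T -> K}).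
Hypothesis eps_mx_stable : forall n, mx_stable eps n.

(** For the augmentation, this is the condition [Q = Q R]. *)
Definition in_kernel_span (Q : lmodType T) : Prop :=
  forall q : Q, exists n (p : 'I_n -> Q) (r : 'I_n -> T),
    (forall i, eps (r i) = 0) /\ q = \sum_(i < n) r i *: p i.

Lemma in_kernel_span_eps0 (Q : lmodType T) n (f : {linear Q -> 'rV[T]_n}) q :
  in_kernel_span Q -> map_mx eps (f q) = 0.
Proof.
move=> QJ; have [k [p [r [r0 ->]]]] := QJ q.
rewrite linear_sum raddf_sum big1 // => i _.
by rewrite linearZ /= map_mxZ r0 scale0r.
Qed.

Lemma lin1_mx_eps0 (Q : lmodType T) m n (f : {linear 'rV[T]_m -> Q})
    (h : {linear Q -> 'rV[T]_n}) :
  in_kernel_span Q -> map_mx eps (lin1_mx (h \o f)) = 0.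
Proof.
move=> QJ; apply/matrixP => i j; rewrite !mxE.
have /rowP/(_ j) := in_kernel_span_eps0 h (f 'e_i) QJ.
by rewrite !mxE.
Qed.

Lemma linear_eq_rV (U : lmodType T) n (f h : {linear 'rV[T]_n -> U}) :
  (forall i, f 'e_i = h 'e_i) -> f =1 h.
Proof.
move=> fh v; rewrite [v]row_sum_delta !linear_sum; apply: eq_bigr => i _.
by rewrite !linearZ fh.
Qed.

(** The map [1 + pi A] below is [1 + (s - 1) c] with [c = p0 i0] of finite rank
and equal to the identity on [L] and on [s L], so that it coincides with [s] on
[L]; likewise [1 + pi B] inverts it there. The second factorization [pi io]
fixes the images of [(s - 1) c] and [(t - 1) c]: this is what turns them into
[pi A] and [pi B], with the matrices [MA] and [MB] of [A pi] and [B pi]. If [U]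
is the invertible correction of [1 + MA], then [u = 1 + pi D] with
[1 + D pi = U] is invertible, and [C], hence the correction, vanishes on [L]. *)
Lemma extend_to_automorphism (Q : lmodType T) (s t : {linear Q -> Q})
    (L : seq Q) :
  countably_generated Q -> projective Q -> in_kernel_span Q ->
  {in L, cancel s t} ->
  exists u u' : {linear Q -> Q},
    [/\ cancel u u', cancel u' u & {in L, u =1 s}].
Proof.
move=> Qcg Qproj QJ st.
have [m [i0 [p0 i0K]]] := local_unit (L ++ map s L) Qcg Qproj.
pose ds : {linear 'rV[T]_m -> Q} := (s \o p0) \- p0.
pose dt : {linear 'rV[T]_m -> Q} := (t \o p0) \- p0.
have [n [io [pi ioK]]] := local_unit
  (codom (fun i => ds 'e_i) ++ codom (fun i => dt 'e_i)) Qcg Qproj.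
have dsK v : pi (io (ds v)) = ds v.
  apply: (linear_eq_rV (f := pi \o io \o ds)) => i /=.
  by apply: ioK; rewrite mem_cat codom_f.
have dtK v : pi (io (dt v)) = dt v.
  apply: (linear_eq_rV (f := pi \o io \o dt)) => i /=.
  by apply: ioK; rewrite mem_cat codom_f orbT.
pose A : {linear Q -> 'rV[T]_n} := io \o ds \o i0.
pose B : {linear Q -> 'rV[T]_n} := io \o dt \o i0.
pose MA := lin1_mx (A \o pi); pose MB := lin1_mx (B \o pi).
have MAE v : A (pi v) = v *m MA by rewrite mul_rV_lin1.
have MBE v : B (pi v) = v *m MB by rewrite mul_rV_lin1.
have MA0 : map_mx eps (1%:M + MA) = 1%:M.
  by rewrite map_mxD map_mx1 lin1_mx_eps0 // addr0.
have MB0 : map_mx eps (1%:M + MB) = 1%:M.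
  by rewrite map_mxD map_mx1 lin1_mx_eps0 // addr0.
have [Y [V]] := eps_mx_stable MA0 MB0.
set U := (X in inverse_mx X V) => -[UV VU].
pose C : {linear Q -> 'rV[T]_n} := (A \+ B) \+ (mulmxr MB \o A).
pose D : {linear Q -> 'rV[T]_n} := A \- (mulmxr Y \o C).
(* [1 + pi C] is the composite of [1 + pi A] and [1 + pi B]. *)
have CE q : C q = A q + B q + A q *m MB by [].
have DE q : D q = A q - C q *m Y by [].
have DpiE v : D (pi v) = v *m U - v.
  have UE : 1%:M - (1%:M + MA) *m (1%:M + MB) = - (MA + MB + MA *m MB).
    rewrite mulmxDr mulmx1 mulmxDl mul1mx -addrA opprD addNKr.
    by rewrite -addrA.
  rewrite /U UE mulNmx DE CE MAE MBE mulmxBr mulmxDr mulmx1.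
  rewrite -!addrA [v + _]addrC -!addrA addNr addr0.
  by rewrite !mulmxA !mulmxDr !mulmxA.
(* The inverse of [1 + pi D] is [1 - pi (1 + D pi)^-1 D]. *)
pose u : {linear Q -> Q} := idfun \+ (pi \o D).
pose u' : {linear Q -> Q} := idfun \- (pi \o (mulmxr V \o D)).
have uE q : u q = q + pi (D q) by [].
have u'E q : u' q = q - pi (D q *m V) by [].
exists u, u'; split=> q.
- rewrite u'E uE [D (_ + _)]linearD DpiE [D q + _]addrC subrK.
  by rewrite -mulmxA UV mulmx1 addrK.
- rewrite uE u'E [D (_ - _)]linearB DpiE -mulmxA VU mulmx1.
  by rewrite opprB [D q + _]addrC !subrK.
move=> qL.
have i0q : p0 (i0 q) = q by apply: i0K; rewrite mem_cat qL.
have i0sq : p0 (i0 (s q)) = s q by apply: i0K; rewrite mem_cat map_f ?orbT.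
have piA : pi (A q) = s q - q by rewrite [pi _]dsK [ds _]/= i0q.
have ABs : A q + B (s q) = 0.
  have -> : A q = io (s q - q) by rewrite [LHS]/= i0q.
  have -> : B (s q) = io (q - s q) by rewrite [LHS]/= i0sq st.
  by rewrite -linearD addrA subrK subrr linear0.
have Cq : C q = 0.
  rewrite CE -MBE -addrA -linearD piA [q + _]addrC subrK; exact: ABs.
by rewrite uE DE Cq mul0mx subr0 piA addrC subrK.
Qed.

(** * Back and forth *)

(** Composed with [pi io], a map on the image of [pi] becomes a map on all of [P]
with the same values on [L]. *)
Lemma precsim_seq (P Q : lmodType T) (L : seq P) :
  countably_generated P -> projective P -> precsim P Q ->
  exists (phi : {linear P -> Q}) (psi : {linear Q -> P}),
    {in L, cancel phi psi}.
Proof.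
move=> Pcg Pproj PQ; have [n [io [pi ioK]]] := local_unit L Pcg Pproj.
have fg : finitely_generated 'rV[T]_n.
  by exists n, (fun i => 'e_i) => x; exists (x 0); exact: row_sum_delta.
have [phi [psi psiK]] := PQ _ (limage_fg pi fg).
exists (phi \o colimage_fun pi \o io : {linear _ -> _}), psi => q qL /=.
by rewrite psiK /= ioK.
Qed.

(** A new partial embedding [phi], defined on more elements, is corrected by an
automorphism of [Q] that sends [phi p] to [a p] for [p] in [L]. *)
Lemma extend_partial_section (P Q : lmodType T) (a : {linear P -> Q})
    (b : {linear Q -> P}) (L M : seq P) :
  countably_generated P -> projective P ->
  countably_generated Q -> projective Q -> in_kernel_span Q ->
  precsim P Q -> {in L, cancel a b} ->
  exists (a1 : {linear P -> Q}) (b1 : {linear Q -> P}),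
    {in L, a1 =1 a} /\ {in L ++ M, cancel a1 b1}.
Proof.
move=> Pcg Pproj Qcg Qproj QJ PQ ab.
have [phi [psi phiK]] := precsim_seq (L ++ M) Pcg Pproj PQ.
have phiKL p : p \in L -> psi (phi p) = p.
  by move=> pL; apply: phiK; rewrite mem_cat pL.
have st : {in map phi L, cancel (a \o psi) (phi \o b)}.
  by move=> _ /mapP[p pL ->] /=; rewrite phiKL ?ab.
have [u [u' [uK u'K us]]] := extend_to_automorphism Qcg Qproj QJ st.
exists (u \o phi : {linear _ -> _}), (psi \o u' : {linear _ -> _}).
split=> p pL /=; last by rewrite uK phiK.
by rewrite us ?map_f //= phiKL.
Qed.

(** Extend [b] first, from [a L] to a set containing [q0]; then extend the left
inverse of this map, from its image to a set containing [p0]. *)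
Lemma back_and_forth_step (P Q : lmodType T) (a : {linear P -> Q})
    (b : {linear Q -> P}) (L : seq P) (p0 : P) (q0 : Q) :
  countably_generated P -> projective P -> in_kernel_span P ->
  countably_generated Q -> projective Q -> in_kernel_span Q ->
  cuntz_equiv P Q -> {in L, cancel a b} ->
  exists (a' : {linear P -> Q}) (b' : {linear Q -> P}) (L' : seq P),
    [/\ {in L', cancel a' b'}, {subset L <= L'}, {in L, a' =1 a}, p0 \in L'
      & exists2 p, p \in L' & a' p = q0].
Proof.
move=> Pcg Pproj PJ Qcg Qproj QJ [PQ QP] ab.
have ba : {in map a L, cancel b a} by move=> _ /mapP[p pL ->]; rewrite ab.
have [b1 [a1 [b1b b1K]]] :=
  extend_partial_section [:: q0] Qcg Qproj Pcg Pproj PJ QP ba.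
pose L1 := map b1 (map a L ++ [:: q0]).
have a1K : {in L1, cancel a1 b1} by move=> _ /mapP[q qL ->]; rewrite b1K.
have [a2 [b2 [a2a1 a2K]]] :=
  extend_partial_section [:: p0] Pcg Pproj Qcg Qproj QJ PQ a1K.
have aL p : p \in L -> a p \in map a L ++ [:: q0].
  by move=> pL; rewrite mem_cat map_f.
have b1a p : p \in L -> b1 (a p) = p by move=> pL; rewrite b1b ?ab ?map_f.
have LL1 p : p \in L -> p \in L1 by move=> pL; rewrite -[p]b1a // map_f ?aL.
have q0L1 : b1 q0 \in L1 by rewrite map_f // mem_cat inE eqxx orbT.
exists a2, b2, (L1 ++ [:: p0]); split=> //.
- by move=> p pL; rewrite mem_cat LL1.
- by move=> p pL; rewrite a2a1 ?LL1 // -{1}[p]b1a // b1K ?aL.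
- by rewrite mem_cat inE eqxx orbT.
- exists (b1 q0); first by rewrite mem_cat q0L1.
  by rewrite a2a1 // b1K // mem_cat inE eqxx orbT.
Qed.

(** On each element of [P] the maps [a n] are eventually constant, and their
eventual value is linear; the maps [b n] recover the element, whence
injectivity. *)
Lemma limit_iso (P Q : lmodType T) (g : nat -> P) (h : nat -> Q)
    (a : nat -> {linear P -> Q}) (b : nat -> {linear Q -> P}) :
  (forall p, exists n (c : nat -> T), p = \sum_(i < n) c i *: g i) ->
  (forall q, exists n (c : nat -> T), q = \sum_(i < n) c i *: h i) ->
  (forall i n, (i < n)%N ->
    a n (g i) = a i.+1 (g i) /\ b n (a n (g i)) = g i) ->
  (forall i, exists p, forall n, (i < n)%N -> a n p = h i) ->
  linear_iso P Q.
Proof.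
move=> gP hQ stab hit.
have ev p : exists N, forall n, (N <= n)%N -> a n p = a N p /\ b n (a n p) = p.
  have [N [c pE]] := gP p; exists N => n Nn.
  rewrite pE !linear_sum; split; apply: eq_bigr => i _; rewrite !linearZ /=.
    have [-> _] := stab i n (leq_trans (ltn_ord i) Nn).
    by have [-> _] := stab i N (ltn_ord i).
  by have [_ ->] := stab i n (leq_trans (ltn_ord i) Nn).
have /choice[f fE] p : exists q, exists N, forall n, (N <= n)%N ->
    a n p = q /\ b n q = p.
  have [N NP] := ev p; exists (a N p), N => n Nn.
  by have [<- bE] := NP n Nn.
have fL : linear f.
  move=> c x y; have [N1 E1] := fE x; have [N2 E2] := fE y.
  have [N3 E3] := fE (c *: x + y).
  pose n := maxn (maxn N1 N2) N3.
  have [<- _] := E1 n (leq_trans (leq_maxl _ _) (leq_maxl _ _)).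
  have [<- _] := E2 n (leq_trans (leq_maxr _ _) (leq_maxl _ _)).
  by have [<- _] := E3 n (leq_maxr _ _); rewrite linearP.
have finj : injective f.
  move=> x y fxy; have [N1 E1] := fE x; have [N2 E2] := fE y.
  have [_ <-] := E1 _ (leq_maxl N1 N2).
  by have [_ <-] := E2 _ (leq_maxr N1 N2); rewrite fxy.
pose F := mklinear fL.
have fsurj q : exists p, f p = q.
  have [n [c ->]] := hQ q; have [p pE] := choice hit.
  exists (\sum_(i < n) c i *: p i); rewrite -[f]/(F : P -> Q) linear_sum.
  apply: eq_bigr => i _; rewrite linearZ /=; congr (_ *: _).
  have [N E] := fE (p i); have [<- _] := E _ (leq_maxl N i.+1).
  by apply: pE; exact: leq_maxr.
have [f' f'K] := choice fsurj.
by exists F, f' => // x; apply: finj; exact: f'K.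
Qed.

Lemma cuntz_equiv_linear_iso (P Q : lmodType T) :
  countably_generated P -> projective P -> in_kernel_span P ->
  countably_generated Q -> projective Q -> in_kernel_span Q ->
  cuntz_equiv P Q -> linear_iso P Q.
Proof.
move=> Pcg Pproj PJ Qcg Qproj QJ PQ.
have [g gP] := Pcg; have [h hQ] := Qcg.
pose stage : Type := {x : {linear P -> Q} * {linear Q -> P} * seq P |
  {in x.2, cancel x.1.1 x.1.2}}.
have step (ix : nat * stage) : exists y : stage,
    [/\ {subset (sval ix.2).2 <= (sval y).2},
        {in (sval ix.2).2, (sval y).1.1 =1 (sval ix.2).1.1},
        g ix.1 \in (sval y).2
      & exists2 p, p \in (sval y).2 & (sval y).1.1 p = h ix.1].
  case: ix => i [[[a b] L] /= ab].
  have [a' [b' [L' [ab' LL' aa' gL' hL']]]] :=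
    back_and_forth_step (g i) (h i) Pcg Pproj PJ Qcg Qproj QJ PQ ab.
  by exists (exist _ (a', b', L') ab').
have [next nextP] := choice step.
have start : stage.
  by exists (\0 : {linear P -> Q}, \0 : {linear Q -> P}, [::]).
pose st := fix st n := if n is i.+1 then next (i, st i) else start.
pose a n := (sval (st n)).1.1; pose b n := (sval (st n)).1.2.
pose L n := (sval (st n)).2.
have abK n : {in L n, cancel (a n) (b n)} := svalP (st n).
have stP i : [/\ {subset L i <= L i.+1}, {in L i, a i.+1 =1 a i},
    g i \in L i.+1 & exists2 p, p \in L i.+1 & a i.+1 p = h i].
  exact: nextP (i, st i).
have keep i p : p \in L i -> forall n, (i <= n)%N -> p \in L n /\ a n p = a i p.
  move=> pL; elim=> [|n IH]; first by rewrite leqn0 => /eqP <-.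
  rewrite leq_eqVlt => /orP[/eqP <- //|/IH[pLn <-]].
  by have [sub aE _ _] := stP n; split; [exact: sub | exact: aE].
apply: (limit_iso (a := a) (b := b) gP hQ) => [i n lt_in|i].
  have [_ _ gL _] := stP i; have [gLn ->] := keep _ _ gL _ lt_in.
  by rewrite -(keep _ _ gL _ lt_in).2 abK.
have [_ _ _ [p pL pE]] := stP i; exists p => n lt_in.
by rewrite (keep _ _ pL _ lt_in).2.
Qed.

End BackAndForth.

(** * The Cuntz semigroup of a ring of stable rank one *)

Section Augmentation.
Variable R : nonUnitalRingType.

Definition augmentation (a : (dorroh R)^c) : int := a.1.

Fact augmentation_is_zmod_morphism : zmod_morphism augmentation.
Proof. by []. Qed.
Fact augmentation_is_monoid_morphism : monoid_morphism augmentation.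
Proof. by split=> // a b; exact: mulrC. Qed.
HB.instance Definition _ := GRing.isZmodMorphism.Build (dorroh R)^c int
  augmentation augmentation_is_zmod_morphism.
HB.instance Definition _ := GRing.isMonoidMorphism.Build (dorroh R)^c int
  augmentation augmentation_is_monoid_morphism.

(** The product of the converse ring is the opposite one, which exchanges the
sides in [a + (1 - a * x) * y]. *)
Lemma stable_rank_one_mx_stable :
  stable_rank_one R ->
  forall n, mx_stable (augmentation : {rmorphism _ -> _}) n.
Proof.
move=> sr n; apply: mx_stable_all => a x a1 _.
pose a' : dorroh R := a; pose x' : dorroh R := x.
have [|y [u [uy yu]]] := sr a' (1 - x' * a') x' _ (subrKC _ _).
  exists a.2; rewrite [a]surjective_pairing; congr pair => /=.
    by rewrite [a.1]a1 subrr.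
  by rewrite subr0.
by exists y, u.
Qed.

Lemma absorbed_in_kernel_span (P : lmodType (dorroh R)^c) :
  absorbed P -> in_kernel_span (augmentation : {rmorphism _ -> _}) P.
Proof.
move=> PR p; have [n [q [r ->]]] := PR p.
by exists n, q, (fun i => dorroh_in (r i)).
Qed.

End Augmentation.

Theorem corollary2 (R : nonUnitalRingType) :
  stable_rank_one R ->
  exists f : Vstar R -> CP R,
    [/\ forall P : cpModule R, f (iso_class P) = cuntz_class P,
        f (Vstar_zero R) = CP_zero R,
        {morph f : x y / Vstar_add x y >-> CP_add x y}
      & bijective f].
Proof.
move=> sr; pose f (x : Vstar R) : CP R := cuntz_class (class_repr x).
have fE P : f (iso_class P) = cuntz_class P.
  by apply/cuntz_classP/linear_iso_cuntz/iso_classP/iso_class_repr.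
exists f; split=> //; first exact: fE.
  move=> x y; rewrite -[x]iso_class_repr -[y]iso_class_repr.
  by rewrite Vstar_addE !fE CP_addE.
exists (fun y => iso_class (class_repr y)) => [x|y]; last first.
  by rewrite fE cuntz_class_repr.
rewrite -[RHS]iso_class_repr; apply/iso_classP.
set P := class_repr (f x); set Q := class_repr x.
have PQ : cuntz_equiv P Q by apply/cuntz_classP/cuntz_class_repr.
case: P Q PQ => [P Pcg Pproj PR] [Q Qcg Qproj QR].
move=> /= PQ.
have [PJ QJ] := (absorbed_in_kernel_span PR, absorbed_in_kernel_span QR).
have srM := stable_rank_one_mx_stable sr.
exact: (cuntz_equiv_linear_iso srM Pcg Pproj PJ Qcg Qproj QJ PQ).
Qed.
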